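(* Let $v_r,\omega_r$ be reference signals and, for each sampling period $T>0$, let $v_{r_k}=v_r(k)$ and $\omega_{r_k}=\omega_r(k)$, $k\in\mathbb{Z}_{\ge0}$, denote the sequences of their samples at times $kT$. Consider the family of discrete-time systems, parameterized by $T>0$, with state $(x_e,y_e,\theta_e)\in\mathbb{R}^3$, $$\begin{aligned} x_e(k+1)&=x_e(k)+T[\,\omega\, y_e(k)-v+v_r(k)\cos\theta_e(k)\,],\\ y_e(k+1)&=y_e(k)+T[\,-\omega\, x_e(k)+v_r(k)\sin\theta_e(k)\,],\\ \theta_e(k+1)&=\theta_e(k)+T[\,\omega_r(k)-\omega\,], \end{aligned}$$ in closed loop with $$\omega=\omega_r(k)+a_1\theta_e(k),\qquad v=v_r(k)+a_2x_e(k)+T\,\vartheta(k,x(k)),\qquad x:=(x_e,y_e)^T .$$ Assume that: 1. there exist $\hat T,w_M>0$ such that for all $T\in(0,\hat T)$ and all $k\ge0$, $$\max\left\{|v_{r_k}|,\ |\omega_{r_k}|,\ \frac{|\omega_{r_k}-\omega_{r_{k-1}}|}{T}\right\}\le w_M$$ (the last quotient being considered for $k\ge1$); 2. the signal $\omega_{r_k}$ is persistently exciting (PE). Then there exists $a_2>0$ such that for all $K,a_1>0$ and all $\vartheta(k,x)$ (real-valued, possibly depending also on $T$) with $|\vartheta(k,x)|\le K|x|$, the closed-loop system is UGAS.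
   Context: $|\cdot|$ is the Euclidean norm. A function $\alpha:\mathbb{R}_{\ge0}\to\mathbb{R}_{\ge0}$ is of class $\mathcal{K}$ if it is continuous, strictly increasing and $\alpha(0)=0$. A function $\beta:\mathbb{R}_{\ge0}\times\mathbb{R}_{\ge0}\to\mathbb{R}_{\ge0}$ is of class $\mathcal{KL}$ if $\beta(\cdot,t)\in\mathcal{K}$ for every $t\ge0$ and $\beta(s,\cdot)$ is decreasing to zero for every $s>0$. For $L,T>0$, $\ell_{L,T}:=\lfloor L/T\rfloor$. Persistency of excitation (PE). Let $\omega_r:\mathbb{Z}_{\ge0}\to\mathbb{R}$ be produced by sampling a function $\psi:\mathbb{R}_{\ge0}\to\mathbb{R}$ with sampling period $T$ (i.e. $\omega_{r_k}=\psi(kT)$). It is PE if there exist positive numbers $\mu,L,T^*$ such that for all $T\in(0,T^* )$ and all integers $j\ge0$: $T\sum_{k=j}^{j+\ell_{L,T}}\omega_{r_k}^2\ge\mu$. UGAS. A family of systems $y(k+1)=F_T(k,y(k))$, $y\in\mathbb{R}^n$, with solution $\phi_T^y(k,k_\circ,y_\circ)$ at time $k$ starting from $y_\circ$ at time $k_\circ$, is uniformly globally asymptotically stable (UGAS) if there exist $\beta\in\mathcal{KL}$ and $T^*>0$ such that for all integers $k\ge k_\circ\ge0$, all $y_\circ\in\mathbb{R}^n$ and all $T\in(0,T^* )$: $|\phi_T^y(k,k_\circ,y_\circ)|\le\beta(|y_\circ|,(k-k_\circ)T)$. Here it is applied to $y=(x_e,y_e,\theta_e)$. *)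

(* Defs.v *)
From HB Require Import structures.
From mathcomp Require Import all_boot all_order all_algebra.
From mathcomp Require Import all_classical all_reals all_analysis.

Set Implicit Arguments.
Unset Strict Implicit.
Unset Printing Implicit Defensive.

Import Order.TTheory GRing.Theory Num.Theory.
Import numFieldNormedType.Exports.

Local Open Scope classical_set_scope.
Local Open Scope ring_scope.

(* The norm that the library puts on matrices is the sup norm, hence this
   separate definition. *)
Definition enorm (R : realType) (n : nat) (y : 'cV[R]_n) : R :=
  Num.sqrt (\sum_i y i 0 ^+ 2).

(* Functions on the nonnegative half-line are represented by total functions
   on R whose values at negative arguments are never constrained or used. *)

Definition classK (R : realType) (alpha : R -> R) : Prop :=
  [/\ forall s, 0 <= s -> 0 <= alpha s,
      {within `[0, +oo[, continuous alpha},
      forall s1 s2, 0 <= s1 -> s1 < s2 -> alpha s1 < alpha s2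
    & alpha 0 = 0].

(* "Decreasing" is taken in the strict sense. *)
Definition classKL (R : realType) (beta : R -> R -> R) : Prop :=
  (forall t, 0 <= t -> classK (beta ^~ t)) /\
  (forall s, 0 < s ->
     (forall t1 t2, 0 <= t1 -> t1 < t2 -> beta s t2 < beta s t1) /\
     beta s t @[t --> +oo] --> 0).

(* [flow f k0 y0 m] is the solution of y(k+1) = f(k, y(k)), y(k0) = y0, at
   time k0 + m. *)
Fixpoint flow (X : Type) (f : nat -> X -> X) (k0 : nat) (y0 : X) (m : nat) : X :=
  if m is m'.+1 then f (k0 + m')%N (flow f k0 y0 m') else y0.

Definition solution (X : Type) (f : nat -> X -> X) (k k0 : nat) (y0 : X) : X :=
  flow f k0 y0 (k - k0).

Definition UGAS (R : realType) (n : nat)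
    (F : R -> nat -> 'cV[R]_n -> 'cV[R]_n) : Prop :=
  exists (beta : R -> R -> R) (Tstar : R),
    [/\ classKL beta, 0 < Tstar &
        forall (k k0 : nat) (y0 : 'cV[R]_n) (T : R),
          (k0 <= k)%N -> 0 < T -> T < Tstar ->
          enorm (solution (F T) k k0 y0) <= beta (enorm y0) ((k - k0)%:R * T)].

Definition sample (R : realType) (psi : R -> R) (T : R) (k : nat) : R :=
  psi (k%:R * T).

(* [Num.truncn] is the floor function on nonnegative arguments. *)
Definition ell (R : realType) (L T : R) : nat := Num.truncn (L / T).

Definition PE (R : realType) (psi : R -> R) : Prop :=
  exists mu L Tstar : R,
    [/\ 0 < mu, 0 < L, 0 < Tstar &
        forall (T : R) (j : nat), 0 < T -> T < Tstar ->
          mu <= T * \sum_(j <= k < (j + ell L T).+1) sample psi T k ^+ 2].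

Definition vec2 (R : realType) (a b : R) : 'cV[R]_2 :=
  \col_i [:: a; b]`_i.

Definition vec3 (R : realType) (a b c : R) : 'cV[R]_3 :=
  \col_i [:: a; b; c]`_i.

(* The state is (x_e, y_e, theta_e), in this order; the perturbation
   [vartheta] of the control v may depend on T, on k and on (x_e, y_e). *)
Definition closed_loop (R : realType) (vr wr : R -> R) (a1 a2 : R)
    (vartheta : R -> nat -> 'cV[R]_2 -> R)
    (T : R) (k : nat) (z : 'cV[R]_3) : 'cV[R]_3 :=
  let xe := z 0 0 in
  let ye := z 1 0 in
  let te := z 2 0 in
  let vrk := sample vr T k in
  let wrk := sample wr T k in
  let w := wrk + a1 * te in
  let v := vrk + a2 * xe + T * vartheta T k (vec2 xe ye) in
  vec3 (xe + T * (w * ye - v + vrk * cos te))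
       (ye + T * (- w * xe + vrk * sin te))
       (te + T * (wrk - w)).

(* Main.v *)
(* Any [a_2 > 0] works; we take [a_2 = 1].  The heading error decays like
   [(1 - a_1 T)^m], so the [(x_e, y_e)] subsystem is a linear system with a
   perturbation of size [|theta_e| (1 + |(x_e, y_e)|)].  For the unperturbed
   part we use the strict Lyapunov function
     [V_k = A (x^2 + y^2) - b w_k x y - u_k y^2],
   where [u_k], a weighted sum of [w_j^2] over one excitation window, satisfies
   [u_(k+1) - u_k >= T mu - T b w_k^2].  This gives
   [V_(k+1) <= (1 - g T) V_k + T G (1 - a_1 T)^k (1 + V_k)] with [g] independent
   of [T] and [G] of order [s + s^2], [s] being the norm of the initial state,
   hence a bound by [(s + s^2) exp (E (s + s^2)) exp (- g t / 2)]. *)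
Require Import Defs.
From HB Require Import structures.
From mathcomp Require Import all_boot all_order all_algebra.
From mathcomp Require Import all_classical all_reals all_analysis.
From mathcomp Require Import ring lra.
Import Order.TTheory GRing.Theory Num.Theory.
Import numFieldNormedType.Exports.
Local Open Scope ring_scope.

(** * Lipschitz bounds for sine and cosine at the origin *)

Lemma normr_sin_le (R : realType) (x : R) : `|sin x| <= `|x|.
Proof.
wlog x0 : x / 0 <= x => [hw|].
  have [/hw//|/ltW x0] := leP 0 x.
  by rewrite -(normrN (sin x)) -sinN -(normrN x) hw// oppr_ge0.
have cs : {within `[0, x], continuous (@sin R)}%classic.
  by apply: continuous_subspaceT => y; exact: continuous_sin.
have [c _] := MVT_segment x0 (fun y _ => is_derive_sin y) cs.
rewrite sin0 !subr0 => ->.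
by rewrite normrM ler_piMl// cos_max.
Qed.

Lemma normr_cosB1_le (R : realType) (x : R) : `|cos x - 1| <= `|x|.
Proof.
have cc : {within `[0, `|x|], continuous (@cos R)}%classic.
  by apply: continuous_subspaceT => y; exact: continuous_cos.
have [c _] := MVT_segment (normr_ge0 x) (fun y _ => is_derive_cos y) cc.
rewrite cos0 cos_norm subr0 => ->.
by rewrite normrM normr_id ler_piMl// normrN sin_max.
Qed.

(** * The potential of a persistently exciting signal *)

(* With [P n = T * \sum_(k < n) w k ^+ 2] the potential is
   [u k = T * \sum_(i < N) (P (k + i.+1) - P k)]; its increment telescopes into
   one full excitation window minus [N * T * (T * w k ^+ 2)]. *)
Lemma excitation_potential {R : realFieldType} {w : nat -> R} {T M b mu : R}
    {N : nat} :
  0 < T -> N%:R * T <= b -> (forall k, `|w k| <= M) ->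
  (forall j, mu <= T * \sum_(j <= k < j + N) w k ^+ 2) ->
  exists u : nat -> R, forall k,
    0 <= u k <= (b * M) ^+ 2 /\ u k + T * mu - T * b * w k ^+ 2 <= u k.+1.
Proof.
move=> T0 NTb wM pe.
pose P n := T * \sum_(0 <= k < n) w k ^+ 2.
have PB k n : P (k + n)%N - P k = T * \sum_(k <= i < k + n) w i ^+ 2.
  rewrite /P -mulrBr (big_cat_nat (n := k))//= ?leq_addr//.
  by rewrite addrAC subrr add0r.
have M0 : 0 <= M by exact: le_trans (wM 0%N).
have wMk k : w k ^+ 2 <= M ^+ 2.
  by rewrite -real_normK ?num_real// lerXn2r ?nnegrE.
have PB0 k n : 0 <= P (k + n)%N - P k.
  by rewrite PB mulr_ge0 ?(ltW T0)// sumr_ge0// => i _; rewrite sqr_ge0.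
have PBM k n : P (k + n)%N - P k <= n%:R * T * M ^+ 2.
  rewrite PB mulrAC mulrC ler_pM2r//.
  apply: (le_trans (ler_sum _ (fun i _ => wMk i))).
  by rewrite sumr_const_nat addKn mulr_natl.
have b0 : 0 <= b by apply: le_trans NTb; rewrite mulr_ge0// ltW.
exists (fun k => T * \sum_(0 <= i < N) (P (k + i.+1)%N - P k)) => k; split.
  apply/andP; split; first by rewrite mulr_ge0 ?(ltW T0)// sumr_ge0.
  (* Each of the [N] summands covers at most [N] samples, so the potential is at most
     [(N * T * M) ^+ 2]; it depends on [T] only through the window length [N * T <= b]. *)
  have : \sum_(0 <= i < N) (P (k + i.+1)%N - P k) <=
         \sum_(0 <= i < N) N%:R * T * M ^+ 2.
    rewrite !big_mkord; apply: ler_sum => i _.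
    apply: (le_trans (PBM _ _)); rewrite ler_wpM2r ?sqr_ge0//.
    by rewrite ler_pM2r// ler_nat.
  rewrite sumr_const_nat subn0 -(ler_pM2l T0) => /le_trans; apply.
  have -> : T * (N%:R * T * M ^+ 2 *+ N) = (N%:R * T * M) ^+ 2.
    by rewrite -[_ *+ N]mulr_natl; ring.
  by rewrite lerXn2r ?nnegrE ?mulr_ge0 ?(ltW T0)// ler_wpM2r.
have -> : \sum_(0 <= i < N) (P (k.+1 + i.+1)%N - P k.+1) =
    \sum_(0 <= i < N) (P (k + i.+1)%N - P k) + (P (k.+1 + N)%N - P k.+1)
    - N%:R * (P k.+1 - P k).
  have tel : \sum_(0 <= i < N) (P (k.+1 + i.+1)%N - P (k + i.+1)%N) =
      P (k.+1 + N)%N - P k.+1.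
    rewrite -[P k.+1]/(P (k.+1)) -[X in _ - P X]addn0.
    rewrite -(@telescope_sumr R 0 N (fun i => P (k.+1 + i)%N))//.
    by apply: eq_bigr => i _; rewrite !addSnnS.
  rewrite -tel !sumrB !sumr_const_nat !subn0 mulrBr !mulr_natl; ring.
have -> : P k.+1 - P k = T * w k ^+ 2.
  by rewrite /P big_nat_recr//= mulrDr addrAC subrr add0r.
have peT : mu <= P (k.+1 + N)%N - P k.+1 by rewrite PB.
have := ler_wpM2r (sqr_ge0 (w k)) NTb.
nra.
Qed.

(** * Contraction under a geometrically decaying perturbation *)

Lemma exprn_1B_le_expR {R : realType} {x : R} (m : nat) :
  x <= 1 -> (1 - x) ^+ m <= expR (- (m%:R * x)).
Proof.
move=> x1; rewrite -mulrN expRM_natl lerXn2r ?nnegrE ?expR_ge0 ?subr_ge0//.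
exact: expR_ge1Dx.
Qed.

(* The perturbation is summable: [v m * expR (G / a * (1 - a * T) ^+ m)] absorbs
   its multiplicative part and obeys a recursion with additive forcing only. *)
Lemma perturbed_contraction {R : realType} {v : nat -> R} {T a g G : R} :
  0 < T -> T <= 1 -> 0 < g -> g <= a -> a * T <= 1 -> 0 <= G ->
  (forall m, 0 <= v m) ->
  (forall m, v m.+1 <= (1 - g * T) * v m
                       + T * G * (1 - a * T) ^+ m * (1 + v m)) ->
  forall m, v m <= (v 0%N + 2 / g * expR g * G) * expR (G / a)
                   * expR (- (g / 2 * (m%:R * T))).
Proof.
move=> T0 T1 g0 ga aT1 G0 v0 step.
have a0 : 0 < a by exact: lt_le_trans ga.
pose q := 1 - a * T.
have q0 : 0 <= q by rewrite subr_ge0.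
have q1 : q <= 1 by rewrite gerBl mulr_ge0 ?ltW.
have qm0 m : 0 <= q ^+ m by rewrite exprn_ge0.
have qm1 m : q ^+ m <= 1 by rewrite exprn_ile1.
have qexp m : q ^+ m <= expR (- (g * (m%:R * T))).
  apply: (le_trans (exprn_1B_le_expR m aT1)).
  by rewrite ler_expR lerN2 mulrCA ler_wpM2l// ler_wpM2r// ltW.
(* Since [g <= a], the forcing decays at least at the rate [g] of the contraction itself; this
   resonance costs the linear factor [m%:R * T]. *)
have main m : v m * expR (G / a * q ^+ m) <=
    (v 0%N + expR g * G * (m%:R * T)) * expR (G / a)
      * expR (- (g * (m%:R * T))).
  elim: m => [|m IH].
    by rewrite mul0r !mulr0 oppr0 expR0 addr0 mulr1 expr0 mulr1.
  (* As [q ^+ m - q ^+ m.+1 = a * T * q ^+ m], the weight shrinks by exactly the factor that cancels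
     the multiplicative perturbation. *)
  have e1 : expR (G / a * q ^+ m.+1) =
      expR (G / a * q ^+ m) * expR (- (T * G * q ^+ m)).
    rewrite -expRD exprS {1}/q; congr expR; field; exact: lt0r_neq0.
  have s1 : v m.+1 <= expR (- (g * T)) * expR (T * G * q ^+ m) * v m
                      + T * G * q ^+ m.
    apply: (le_trans (step m)); rewrite -/q mulrDr mulr1 addrCA addrC lerD2r.
    rewrite -mulrDl ler_wpM2r// -expRD.
    by apply: le_trans (expR_ge1Dx _); rewrite addrA.
  have e2 : v m.+1 * expR (G / a * q ^+ m.+1) <=
      expR (- (g * T)) * (v m * expR (G / a * q ^+ m))
      + T * G * q ^+ m * expR (G / a).
    apply: (le_trans (ler_wpM2r (expR_ge0 _) s1)); rewrite mulrDl lerD//.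
      rewrite e1 -[X in _ <= X]mulr1 -(expRxMexpNx_1 (T * G * q ^+ m)).
      by rewrite le_eqVlt; apply/orP; left; apply/eqP; ring.
    have Ga0 : 0 <= G / a by rewrite divr_ge0// ltW.
    by rewrite ler_wpM2l ?mulr_ge0 ?(ltW T0)// ler_expR ler_piMr.
  apply: (le_trans e2).
  have eS : expR (- (g * (m.+1%:R * T))) =
      expR (- (g * T)) * expR (- (g * (m%:R * T))).
    by rewrite -expRD; congr expR; rewrite -natr1; ring.
  (* The shift from [m] to [m.+1] costs [expR (g * T)], at most [expR g] because [T <= 1]. *)
  have qS : q ^+ m <= expR g * expR (- (g * (m.+1%:R * T))).
    apply: (le_trans (qexp m)).
    rewrite eS [X in _ <= X]mulrA ler_peMl ?expR_ge0//.
    by rewrite -expRD -[X in X <= _]expR0 ler_expR; nra.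
  have H1 := ler_wpM2l (expR_ge0 (- (g * T))) IH.
  have TG0 : 0 <= T * G * expR (G / a).
    by rewrite !mulr_ge0 ?expR_ge0// ltW.
  have H2 := ler_wpM2l TG0 qS.
  apply: (@le_trans _ _ (expR (- (g * T)) * (
     (v 0%N + expR g * G * (m%:R * T)) * expR (G / a)
      * expR (- (g * (m%:R * T)))) + T * G * expR (G / a) *
     (expR g * expR (- (g * (m.+1%:R * T)))))).
    by rewrite lerD// mulrAC.
  by rewrite eS -natr1 le_eqVlt; apply/orP; left; apply/eqP; ring.
move=> m; set t := m%:R * T.
have t0 : 0 <= t by rewrite mulr_ge0// ltW.
set h := expR (- (g / 2 * t)).
have h0 : 0 <= h by exact: expR_ge0.
have h1 : h <= 1 by rewrite expR_le1 oppr_le0 mulr_ge0// divr_ge0// ltW.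
have hh : expR (- (g * t)) = h * h by rewrite -expRD; congr expR; field.
(* Half of the decay rate is given up to absorb the linear factor [t]. *)
have th : t * h <= 2 / g.
  rewrite ler_pdivlMr//.
  have := ler_wpM2r h0 (ltW (lt_le_trans (ltr_pwDl ltr01 (lexx (g / 2 * t)))
    (expR_ge1Dx (g / 2 * t)))).
  by rewrite /h expRxMexpNx_1; lra.
have gG0 : 0 <= expR g * G by rewrite mulr_ge0 ?expR_ge0.
apply: (@le_trans _ _ (v m * expR (G / a * q ^+ m))).
  by rewrite ler_peMr// -[X in X <= _]expR0 ler_expR mulr_ge0// divr_ge0// ltW.
apply: (le_trans (main m)); rewrite -/t hh.
rewrite mulrAC [X in _ <= X]mulrAC ler_wpM2r ?expR_ge0// mulrA ler_wpM2r//.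
have := ler_wpM2l gG0 th; have := ler_wpM2l (v0 0%N) h1.
nra.
Qed.

(** * The strict Lyapunov function of the position error *)

(* Writing [X], [Y] for the velocities, all second-order terms in [T] are
   bounded through [e >= |x|, |y|, |X|, |Y|].  The first-order part of the
   increment of [- b * w * x * y] contributes [- b * w ^+ 2 * y ^+ 2], which
   compensates the loss of the excitation potential [u]. *)
Lemma lyapunov_step {R : realFieldType}
    {A b M B mu T w w' u u' x y p q r P x' y' : R} :
  0 <= b -> 0 < T -> T <= 1 -> 0 <= A ->
  0 <= M -> `|w| <= M -> `|w' - w| <= T * M ->
  0 <= u' <= B -> u + T * mu - T * b * w ^+ 2 <= u' ->
  0 <= r -> r ^+ 2 = x ^+ 2 + y ^+ 2 -> `|p| <= P -> `|q| <= P ->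
  x' = x + T * (w * y - x + p) -> y' = y + T * (- w * x + q) ->
  A * (x' ^+ 2 + y' ^+ 2) - b * w' * x' * y' - u' * y' ^+ 2 <=
  A * (x ^+ 2 + y ^+ 2) - b * w * x * y - u * y ^+ 2
  + T * (- 2 * A * x ^+ 2 - mu * y ^+ 2
         + 2 * (b * M + B * M) * (`|x| * `|y|) + b * M ^+ 2 * x ^+ 2)
  + T * ((4 * A + 2 * b * M + 2 * B) * (r * P))
  + T ^+ 2 * ((2 * A + 4 * b * M) * ((M + 1) * r + P) ^+ 2).
Proof.
move=> b0 T0 T1 A0 M0 wM dwM /andP[u'0 u'B] du r0 rxy pP qP -> ->.
have xr : `|x| <= r.
  by rewrite -ler_sqr ?nnegrE// real_normK ?num_real// rxy lerDl sqr_ge0.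
have yr : `|y| <= r.
  by rewrite -ler_sqr ?nnegrE// real_normK ?num_real// rxy lerDr sqr_ge0.
set e := (M + 1) * r + P.
have P0 : 0 <= P by exact: le_trans (normr_ge0 p) pP.
pose X := w * y - x + p; pose Y := - w * x + q.
have mulle (s t c d : R) : `|s| <= c -> `|t| <= d -> `|s * t| <= c * d.
  by move=> sc td; rewrite normrM ler_pM.
have xe : `|x| <= e by apply: (le_trans xr); rewrite /e; nra.
have ye : `|y| <= e by apply: (le_trans yr); rewrite /e; nra.
have Xe : `|X| <= e.
  rewrite /e mulrDl mul1r; apply: (le_trans (ler_normD _ _)).
  by rewrite lerD// (le_trans (ler_normB _ _))// lerD// mulle.
have Ye : `|Y| <= e.
  rewrite /e mulrDl mul1r; apply: (le_trans (ler_normD _ _)).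
  rewrite lerD// mulNr normrN; apply: le_trans (mulle _ _ _ _ wM xr) _.
  by rewrite lerDl.
have up (s c : R) : `|s| <= c -> s <= c /\ - c <= s.
  by rewrite ler_norml => /andP[].
have e0 : 0 <= e by exact: le_trans xe.
have b0T : 0 <= b * T by rewrite mulr_ge0 ?(ltW T0).
have T20 : 0 <= T ^+ 2 by exact: sqr_ge0.
have bnd (s c : R) (h : `|s| <= c) := (up s c h).1.
have bndN (s c : R) (h : `|s| <= c) := (up s c h).2.
(* The facts [t1] to [t16] bound the terms of the expanded increment one by one, and the final [lra]
   adds them up. In the [A] part the rotation terms cancel at first order. *)
have t1 : A * T ^+ 2 * (X ^+ 2 + Y ^+ 2) <= 2 * A * T ^+ 2 * e ^+ 2.
  have := lerXn2r 2 (normr_ge0 X) e0 Xe; rewrite real_normK ?num_real// => hX.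
  have := lerXn2r 2 (normr_ge0 Y) e0 Ye; rewrite real_normK ?num_real// => hY.
  by have := ler_wpM2l (mulr_ge0 A0 T20) (lerD hX hY); lra.
have t2 : - (b * (w' - w) * (x * y)) <= b * T * M * (`|x| * `|y|).
  have := bndN _ _ (mulle _ _ _ _ dwM (lexx `|x * y|)).
  by move=> /(ler_wpM2l b0); rewrite normrM; lra.
have t3 : - (b * T * (w' - w) * (X * y)) <= b * T ^+ 2 * M * e ^+ 2.
  have := ler_wpM2l b0T
    (bndN _ _ (mulle _ _ _ _ dwM (mulle _ _ _ _ Xe ye))).
  by lra.
have t4 : - (b * T * (w' - w) * (x * Y)) <= b * T ^+ 2 * M * e ^+ 2.
  have := ler_wpM2l b0T
    (bndN _ _ (mulle _ _ _ _ dwM (mulle _ _ _ _ xe Ye))).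
  by lra.
(* This term is of third order in [T]; [T <= 1] lowers it to second order. *)
have t5 : - (b * T ^+ 2 * (w' - w) * (X * Y)) <= b * T ^+ 2 * M * e ^+ 2.
  have := ler_wpM2l (mulr_ge0 b0 T20)
    (bndN _ _ (mulle _ _ _ _ dwM (mulle _ _ _ _ Xe Ye))).
  have := ler_wpM2r
    (mulr_ge0 (mulr_ge0 b0T (ltW T0)) (mulr_ge0 M0 (sqr_ge0 e))) T1.
  by lra.
have t6 : - (b * T ^+ 2 * w * (X * Y)) <= b * T ^+ 2 * M * e ^+ 2.
  by have := ler_wpM2l (mulr_ge0 b0 T20)
    (bndN _ _ (mulle _ _ _ _ wM (mulle _ _ _ _ Xe Ye))); lra.
have t7 : b * T * w * (x * y) <= b * T * M * (`|x| * `|y|).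
  have := bnd _ _ (mulle _ _ _ _ wM (lexx `|x * y|)).
  by move=> /(ler_wpM2l b0T); rewrite normrM; lra.
have t8 : - (b * T * w * (p * y)) <= b * T * M * (r * P).
  have := ler_wpM2l b0T
    (bndN _ _ (mulle _ _ _ _ wM (mulle _ _ _ _ pP yr))).
  by lra.
have t9 : - (b * T * w * (q * x)) <= b * T * M * (r * P).
  have := ler_wpM2l b0T
    (bndN _ _ (mulle _ _ _ _ wM (mulle _ _ _ _ qP xr))).
  by lra.
have t10 : b * T * w ^+ 2 * x ^+ 2 <= b * T * M ^+ 2 * x ^+ 2.
  have := lerXn2r 2 (normr_ge0 w) M0 wM; rewrite real_normK ?num_real// => hw.
  by have := ler_wpM2l (mulr_ge0 b0T (sqr_ge0 x)) hw; lra.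
have t11 : (u + T * mu - T * b * w ^+ 2) * y ^+ 2 <= u' * y ^+ 2.
  by rewrite ler_wpM2r ?sqr_ge0.
have u'N : `|u'| <= B by rewrite ger0_norm.
have t12 : 2 * T * u' * (w * (x * y)) <= 2 * T * B * M * (`|x| * `|y|).
  have T2 : 0 <= 2 * T by rewrite mulr_ge0// ltW.
  have := bnd _ _ (mulle _ _ _ _ u'N (mulle _ _ _ _ wM (lexx `|x * y|))).
  by move=> /(ler_wpM2l T2); rewrite normrM; lra.
have t13 : - (2 * T * u' * (q * y)) <= 2 * T * B * (r * P).
  have T2 : 0 <= 2 * T by rewrite mulr_ge0// ltW.
  have := ler_wpM2l T2
    (bndN _ _ (mulle _ _ _ _ u'N (mulle _ _ _ _ qP yr))).
  by lra.
have t14 : 0 <= T ^+ 2 * u' * Y ^+ 2 by rewrite mulr_ge0 ?sqr_ge0// mulr_ge0.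
have t15 : 2 * A * T * (x * p) <= 2 * A * T * (r * P).
  have A2 : 0 <= 2 * A * T by rewrite !mulr_ge0// ltW.
  by have := ler_wpM2l A2 (bnd _ _ (mulle _ _ _ _ xr pP)); lra.
have t16 : 2 * A * T * (y * q) <= 2 * A * T * (r * P).
  have A2 : 0 <= 2 * A * T by rewrite !mulr_ge0// ltW.
  by have := ler_wpM2l A2 (bnd _ _ (mulle _ _ _ _ yr qP)); lra.
rewrite /X /Y in t1 t3 t4 t5 t6 t14.
lra.
Qed.

Definition lyapunov {R : pzRingType} (A b w u x y : R) : R :=
  A * (x ^+ 2 + y ^+ 2) - b * w * x * y - u * y ^+ 2.

(** For [A] large, the first-order part of the increment is at most [- T * (mu / 2) * r ^+ 2]. Half
    of this pays for the terms in [T ^+ 2 * r ^+ 2] when [T <= T0], and the other half contracts the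
    function. All remaining terms carry a factor [|th|] or [th ^+ 2] and go into [C]. The [T * r] in
    the bounds on [p] and [q] accounts for [vartheta]; it only enters at second order in [T]. *)
Lemma lyapunov_decrease {R : realFieldType} {b M B mu c a : R} :
  0 <= b -> 0 <= M -> 0 <= B -> 0 < mu -> 0 <= c -> 0 < a ->
  exists A D g C T0 : R, [/\ 0 <= D, 0 < g, g <= a, 0 <= C & 0 < T0] /\
  (forall w u x y : R, `|w| <= M -> 0 <= u <= B ->
     x ^+ 2 + y ^+ 2 <= lyapunov A b w u x y <= D * (x ^+ 2 + y ^+ 2)) /\
  forall T w w' u u' x y p q r th x' y' : R,
    0 < T -> T <= 1 -> T <= T0 ->
    `|w| <= M -> `|w' - w| <= T * M ->
    0 <= u <= B -> 0 <= u' <= B -> u + T * mu - T * b * w ^+ 2 <= u' ->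
    0 <= r -> r ^+ 2 = x ^+ 2 + y ^+ 2 ->
    `|p| <= c * (`|th| * (1 + r) + T * r) ->
    `|q| <= c * (`|th| * (1 + r) + T * r) ->
    x' = x + T * (w * y - x + p) -> y' = y + T * (- w * x + q) ->
    lyapunov A b w' u' x' y' <= (1 - g * T) * lyapunov A b w u x y
      + T * (C * (`|th| + th ^+ 2)) * (1 + lyapunov A b w u x y).
Proof.
move=> b0 M0 B0 mu0 c0 a0.
have bM0 : 0 <= b * M by rewrite mulr_ge0.
have BM0 : 0 <= B * M by rewrite mulr_ge0.
have bMM0 : 0 <= b * M ^+ 2 by rewrite mulr_ge0 ?sqr_ge0.
pose c1 := b * M + B * M.
have c10 : 0 <= c1 ^+ 2 / mu by rewrite divr_ge0 ?sqr_ge0// ltW.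
(* The first three summands make the function dominate [x ^+ 2 + y ^+ 2]; the last three outweigh
   the positive terms in [q1]. *)
pose A := b * M + B + 1 + b * M ^+ 2 + c1 ^+ 2 / mu + mu.
pose D := A + b * M.
have A0 : 0 < A by rewrite /A; lra.
have D0 : 0 < D by rewrite /D; lra.
pose c2 := 4 * A + 2 * b * M + 2 * B.
pose c3 := 2 * A + 4 * b * M.
have c20 : 0 <= c2 by rewrite /c2; lra.
have c30 : 0 <= c3 by rewrite /c3; lra.
(* [C4] collects the coefficients of [T ^+ 2 * r ^+ 2]; [C5] adds up those of [T * h * (1 + r ^+ 2)]
   and [T * h ^+ 2 * (1 + r ^+ 2)], where [h] is [|th|]. *)
pose C4 := c2 * c + c3 * (2 * (M + 1) ^+ 2 + 4 * c ^+ 2).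
pose C5 := 2 * c2 * c + 8 * c3 * c ^+ 2.
have C40 : 0 <= C4.
  by rewrite addr_ge0 ?mulr_ge0// addr_ge0// mulr_ge0 ?sqr_ge0.
have C50 : 0 <= C5 by rewrite addr_ge0 ?mulr_ge0 ?sqr_ge0.
pose g := Num.min (mu / (4 * D)) a.
have g0 : 0 < g by rewrite lt_min a0 andbT divr_gt0// mulr_gt0.
have gmu : g * D <= mu / 4.
  have : g <= mu / (4 * D) by rewrite ge_min lexx.
  move=> /(ler_wpM2r (ltW D0)) /le_trans; apply.
  rewrite le_eqVlt; apply/orP; left; apply/eqP; field.
  exact: lt0r_neq0.
have T00 : 0 < mu / (4 * (C4 + 1)) by rewrite divr_gt0// mulr_gt0// ltr_wpDl.
exists A, D, g, C5, (mu / (4 * (C4 + 1))); split.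
  by split=> //; [exact: ltW | rewrite ge_min lexx orbT].
have sandwich (w u x y : R) : `|w| <= M -> 0 <= u <= B ->
    x ^+ 2 + y ^+ 2 <= lyapunov A b w u x y <= D * (x ^+ 2 + y ^+ 2).
  move=> wM /andP[u0 uB].
  have xy2 : `|x * y| <= x ^+ 2 + y ^+ 2.
    have := (sqr_ge0 x, sqr_ge0 y, sqr_ge0 (x + y), sqr_ge0 (x - y)).
    by move=> [[[? ?] ?] ?]; rewrite ler_norml; apply/andP; split; lra.
  have : `|w * (x * y)| <= M * (x ^+ 2 + y ^+ 2).
    by rewrite normrM ler_pM.
  rewrite ler_norml => /andP[/(ler_wpM2l b0) h1 /(ler_wpM2l b0) h2].
  have h3 : u * y ^+ 2 <= B * y ^+ 2 by rewrite ler_wpM2r ?sqr_ge0.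
  have h4 : 0 <= u * y ^+ 2 by rewrite mulr_ge0 ?sqr_ge0.
  have h5 : 0 <= B * x ^+ 2 by rewrite mulr_ge0 ?sqr_ge0.
  have h6 : 0 <= (A - b * M - B - 1) * (x ^+ 2 + y ^+ 2).
    by apply: mulr_ge0; [rewrite /A; lra | rewrite addr_ge0 ?sqr_ge0].
  by rewrite /lyapunov /D; apply/andP; split; lra.
split=> // T w w' u u' x y p q r th x' y' T0 T1 TT0 wM dwM uB u'B du r0 rxy
  pP qP ex' ey'.
set P := c * (`|th| * (1 + r) + T * r) in pP qP.
have := lyapunov_step b0 T0 T1 (ltW A0) M0 wM dwM u'B du r0 rxy pP qP ex' ey'.
rewrite -/(lyapunov A b w' u' x' y') -/(lyapunov A b w u x y).
have /andP[lo hi] := sandwich w u x y wM uB.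
set V' := lyapunov _ _ w' _ _ _; set V := lyapunov _ _ w _ _ _ in lo hi *.
rewrite -rxy in lo hi *; rewrite -/c2 -/c3 => step.
pose h : R := `|th|.
have h0 : 0 <= h by exact: normr_ge0.
have hh : th ^+ 2 = h ^+ 2 by rewrite real_normK ?num_real.
rewrite -/h in P pP qP step *; rewrite hh.
(* Young's inequality: half of [mu * y ^+ 2] absorbs the mixed term, at the price of
   [2 * c1 ^+ 2 / mu] times [x ^+ 2], which [A] covers. *)
have q1 : - 2 * A * x ^+ 2 - mu * y ^+ 2 + 2 * c1 * (`|x| * `|y|)
          + b * M ^+ 2 * x ^+ 2 <= - (mu / 2) * r ^+ 2.
  rewrite rxy -[x ^+ 2]real_normK ?num_real// -[y ^+ 2]real_normK ?num_real//.
  have : 0 <= mu^-1 * (2 * c1 * `|x| - mu * `|y|) ^+ 2 / 2.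
    by rewrite divr_ge0// mulr_ge0 ?sqr_ge0// invr_ge0 ltW.
  rewrite (_ : _ / 2 = 2 * (c1 ^+ 2 / mu) * `|x| ^+ 2 - 2 * c1 * (`|x| * `|y|)
    + mu / 2 * `|y| ^+ 2); last by field; exact: lt0r_neq0.
  have := mulr_ge0 (ltW mu0) (sqr_ge0 `|x|).
  have := mulr_ge0 bMM0 (sqr_ge0 `|x|).
  have := mulr_ge0 (addr_ge0 (addr_ge0 bM0 B0) ler01) (sqr_ge0 `|x|).
  by rewrite /A; lra.
have rr : r <= 1 + r ^+ 2 by nra.
have q2 : r * P <= c * (2 * h * (1 + r ^+ 2) + T * r ^+ 2).
  rewrite /P mulrCA ler_wpM2l//.
  by have := ler_wpM2l h0 rr; lra.
have q3 : P ^+ 2 <= 4 * c ^+ 2 * (h ^+ 2 * (1 + r ^+ 2)) + 2 * c ^+ 2 * r ^+ 2.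
  rewrite /P exprMn.
  have k1 : (h * (1 + r) + T * r) ^+ 2 <=
      4 * h ^+ 2 * (1 + r ^+ 2) + 2 * r ^+ 2.
    have k2 : (h * (1 + r) + T * r) ^+ 2 <=
      2 * (h ^+ 2 * (1 + r) ^+ 2) + 2 * (T ^+ 2 * r ^+ 2).
      by have := sqr_ge0 (h * (1 + r) - T * r); lra.
    have k3 : T ^+ 2 * r ^+ 2 <= r ^+ 2.
      by rewrite ler_piMl ?sqr_ge0// expr_le1// ltW.
    have : 0 <= h ^+ 2 * (1 - r) ^+ 2 by rewrite mulr_ge0 ?sqr_ge0.
    by lra.
  by have := ler_wpM2l (sqr_ge0 c) k1; lra.
have q4 : ((M + 1) * r + P) ^+ 2 <= 2 * (M + 1) ^+ 2 * r ^+ 2 + 2 * P ^+ 2.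
  by have := sqr_ge0 ((M + 1) * r - P); lra.
have TC4 : T * C4 <= mu / 4.
  have : T * (C4 + 1) <= mu / 4.
    apply: (le_trans (ler_wpM2r _ TT0)); first by lra.
    rewrite le_eqVlt; apply/orP; left; apply/eqP; field.
    by rewrite lt0r_neq0// ltr_wpDl.
  by lra.
have r20 : 0 <= r ^+ 2 by exact: sqr_ge0.
have m1 := ler_wpM2l (ltW T0) q1.
have m2 := ler_wpM2l (ltW T0) (ler_wpM2l c20 q2).
have T20 : 0 <= T ^+ 2 by exact: sqr_ge0.
have m3 := ler_wpM2l T20 (ler_wpM2l c30 q4).
have m4 := ler_wpM2l T20 (ler_wpM2l c30 q3).
have m5 : T ^+ 2 * (c3 * (c ^+ 2 * (h ^+ 2 * (1 + r ^+ 2)))) <=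
          T * (c3 * (c ^+ 2 * (h ^+ 2 * (1 + r ^+ 2)))).
  rewrite ler_wpM2r//; last by rewrite expr2 ler_piMl// ltW.
  by rewrite !mulr_ge0 ?sqr_ge0// addr_ge0.
have m6 := ler_wpM2l (mulr_ge0 (ltW T0) r20) TC4.
have m7 : g * V <= mu / 4 * r ^+ 2.
  apply: (le_trans (ler_wpM2l (ltW g0) hi)).
  by rewrite mulrA ler_wpM2r.
have m8 := ler_wpM2l (ltW T0) m7.
have m9 : T * (C5 * (h + h ^+ 2)) * (1 + r ^+ 2) <=
          T * (C5 * (h + h ^+ 2)) * (1 + V).
  by rewrite ler_wpM2l ?lerD2l// !mulr_ge0 ?(ltW T0)// addr_ge0// sqr_ge0.
(* [C5 * (h + h ^+ 2)] pairs both parts of [C5] with both powers of [h]; [m10] and [m11] give the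
   signs of the surplus products. *)
have m10 : 0 <= T * (c2 * (c * (h ^+ 2 * (1 + r ^+ 2)))).
  by rewrite !mulr_ge0 ?(ltW T0) ?sqr_ge0// addr_ge0.
have m11 : 0 <= T * (c3 * (c ^+ 2 * (h * (1 + r ^+ 2)))).
  by rewrite !mulr_ge0 ?(ltW T0) ?sqr_ge0// addr_ge0.
apply: (le_trans step); rewrite -/c1.
clearbody h P c1 c2 c3 V V' g.
rewrite /C4 /C5 in m6 m9 *; clear - m1 m2 m3 m4 m5 m6 m8 m9 m10 m11.
lra.
Qed.

(** * The comparison function *)

(** The decay estimate concerns the squared norm, hence the root. One constant [D] serves as
    amplitude and exponent. *)
Lemma classKL_sqrt_exp {R : realType} {D d : R} : 0 < D -> 0 < d ->
  classKL (fun s t => Num.sqrt (D * (s + s ^+ 2) * expR (D * (s + s ^+ 2))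
                                * expR (- (d * t)))).
Proof.
move=> D0 d0.
have h0 s : 0 <= s -> 0 <= D * (s + s ^+ 2).
  by move=> s0; rewrite mulr_ge0 ?(ltW D0)// addr_ge0 ?sqr_ge0.
have hlt s1 s2 : 0 <= s1 -> s1 < s2 -> D * (s1 + s1 ^+ 2) < D * (s2 + s2 ^+ 2).
  by move=> s10 s12; rewrite ltr_pM2l//; nra.
split=> [t t0|s s0].
  split=> [s s0||s1 s2 s10 s12|].
  - exact: sqrtr_ge0.
  - apply: continuous_subspaceT => s.
    have ch : ((fun s : R => D * (s + s ^+ 2)) @ s
               --> D * (s + s ^+ 2))%classic.
      apply: cvgM; first exact: cvg_cst.
      by apply: cvgD; [exact: cvg_id | exact: exprn_continuous].
    apply: (continuous_cvg _ (@sqrt_continuous R _)).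
    apply: cvgM; last exact: cvg_cst.
    apply: cvgM; first exact: ch.
    exact: (continuous_cvg _ (@continuous_expR R _) ch).
  - have s2h : 0 < D * (s2 + s2 ^+ 2) by rewrite (le_lt_trans (h0 _ s10))// hlt.
    have s2e := mulr_gt0 s2h (expR_gt0 (D * (s2 + s2 ^+ 2))).
    rewrite ltr_sqrt; last by rewrite mulr_gt0 ?expR_gt0.
    rewrite ltr_pM2r ?expR_gt0//.
    apply: (@le_lt_trans _ _ (D * (s1 + s1 ^+ 2) * expR (D * (s2 + s2 ^+ 2)))).
      by rewrite ler_wpM2l ?h0// ler_expR ltW// hlt.
    by rewrite ltr_pM2r ?expR_gt0// hlt.
  - by rewrite expr0n addr0 mulr0 !mul0r sqrtr0.
have hs : 0 < D * (s + s ^+ 2) * expR (D * (s + s ^+ 2)).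
  by rewrite mulr_gt0 ?expR_gt0// mulr_gt0// addr_gt0// exprn_gt0.
split=> [t1 t2 _ t12|].
  rewrite ltr_sqrt; last by rewrite mulr_gt0 ?expR_gt0.
  by rewrite ltr_pM2l// ltr_expR ltrN2 ltr_pM2l.
have lim : (D * (s + s ^+ 2) * expR (D * (s + s ^+ 2)) * expR (- (d * t))
            @[t --> +oo] --> (0 : R))%classic.
  rewrite -[X in (_ --> X)%classic](mulr0 (D * (s + s ^+ 2) * expR (D * (s + s ^+ 2)))).
  apply: cvgM; first exact: cvg_cst.
  apply: (@cvg_comp _ _ _ (fun t => d * t) (fun t => expR (- t)) _ +oo);
    last exact: cvgr_expR.
  exact: gt0_cvgMry.
rewrite -[X in (_ --> X)%classic](@sqrtr0 R).
exact: (continuous_cvg _ (@sqrt_continuous R 0) lim).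
Qed.

Theorem proposition3 (R : realType) (vr wr : R -> R)
    (Hbound : exists That wM : R,
       [/\ 0 < That, 0 < wM &
           forall (T : R) (k : nat), 0 < T -> T < That ->
             [/\ `|sample vr T k| <= wM,
                 `|sample wr T k| <= wM &
                 (1 <= k)%N ->
                   `|sample wr T k - sample wr T k.-1| / T <= wM]])
    (HPE : PE wr) :
  exists a2 : R, 0 < a2 /\
    forall (K a1 : R) (vartheta : R -> nat -> 'cV[R]_2 -> R),
      0 < K -> 0 < a1 ->
      (forall (T : R) (k : nat) (x : 'cV[R]_2),
         0 < T -> `|vartheta T k x| <= K * enorm x) ->
      UGAS (closed_loop vr wr a1 a2 vartheta).
Proof.

(* Application to the closed loop *)
have [That [M [That0 M0 bound]]] := Hbound.
have [mu [L [Tp [mu0 L0 Tp0 pe]]]] := HPE.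
exists 1; split=> // K a1 vth K0 a10 vthK.
(* An excitation window has [(ell L T).+1] samples, both ends being included, so its duration is at
   most [L + T <= L + 1]. *)
pose b := L + 1.
have b0 : 0 <= b by rewrite addr_ge0// ltW.
(* The three summands come from the heading feedback, the reference velocity and [vartheta]. *)
pose c := a1 + M + K.
have c0 : 0 <= c by rewrite !addr_ge0// ltW.
have [A [D [g [C [T0 [[D0 g0 ga C0 T00] [sandwich decr]]]]]]] :=
  lyapunov_decrease b0 (ltW M0) (sqr_ge0 (b * M)) mu0 c0 a10.
(* [D] and the next summand bound the amplitude, [C / a1] the exponent, and [1] makes room for the
   heading error. *)
pose E := D + 2 / g * expR g * C + C / a1 + 1.
have gC0 : 0 <= 2 / g * expR g * C.
  by rewrite !mulr_ge0 ?expR_ge0// invr_ge0 ltW.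
have Ca0 : 0 <= C / a1 by rewrite divr_ge0// ltW.
have E0 : 0 < E by rewrite /E; lra.
have g20 : 0 < g / 2 by rewrite divr_gt0.
exists (fun s t => Num.sqrt (E * (s + s ^+ 2) * expR (E * (s + s ^+ 2))
                                * expR (- (g / 2 * t)))).
exists (Num.min (Num.min That Tp) (Num.min T0 (Num.min 1 a1^-1))).
split; first exact: classKL_sqrt_exp.
  by rewrite !lt_min That0 Tp0 T00 ltr01 invr_gt0.
move=> k k0 z0 T k0k Tgt0.
rewrite !lt_min => /andP[/andP[TThat TTp] /andP[/ltW TT0 /andP[/ltW T1 Ta1]]].
have {}Ta1 : a1 * T <= 1.
  by rewrite mulrC -ler_pdivlMr// div1r ltW.
rewrite /solution; move: (k - k0)%N => m {k k0k}.
(* Time is counted from [k0]. The bounds and the excitation hold at all times with the same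
   constants, whence uniformity in [k0]. *)
pose w k := sample wr T (k0 + k).
have wM k : `|w k| <= M by have [] := bound T (k0 + k)%N Tgt0 TThat.
have vM k : `|sample vr T (k0 + k)| <= M.
  by have [] := bound T (k0 + k)%N Tgt0 TThat.
have dwM k : `|w k.+1 - w k| <= T * M.
  have [_ _ /(_ isT)] := bound T (k0 + k).+1 Tgt0 TThat.
  by rewrite ler_pdivrMr// /w addnS [T * M]mulrC.
have NT : (ell L T).+1%:R * T <= b.
  rewrite -natr1 mulrDl mul1r lerD// -ler_pdivlMr//.
  by rewrite Num.Theory.truncn_le divr_ge0// ltW.
have pe' j : mu <= T * \sum_(j <= k < j + (ell L T).+1) w k ^+ 2.
  apply: (le_trans (pe T (k0 + j)%N Tgt0 TTp)).
  rewrite ler_pM2l// -addnS -addnA addnC big_addn addKn.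
  by rewrite le_eqVlt; under eq_bigr do rewrite addnC; rewrite eqxx.
have [u uP] := excitation_potential Tgt0 NT wM pe'.
pose z := flow (closed_loop vr wr a1 1 vth T) k0 z0.
pose x k := z k 0 0; pose y k := z k 1 0; pose th k := z k 2 0.
have zS k : z k.+1 = closed_loop vr wr a1 1 vth T (k0 + k) (z k) by [].
have sqnorm k : enorm (z k) ^+ 2 = x k ^+ 2 + y k ^+ 2 + th k ^+ 2.
  rewrite /enorm sqr_sqrtr; last by rewrite sumr_ge0// => i _; rewrite sqr_ge0.
  rewrite !big_ord_recl big_ord0 addr0 addrA.
  by congr (_ + _ + _); congr (z k _ _ ^+ 2); apply: val_inj.
(* The reference velocity survives only through [cos (th k) - 1] and [sin (th k)], so at zero
   heading error only the term with [vth] perturbs the linear system. *)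
have xS k : x k.+1 = x k + T * (w k * y k - x k +
    (a1 * th k * y k - T * vth T (k0 + k)%N (vec2 (x k) (y k))
     + sample vr T (k0 + k) * (cos (th k) - 1))).
  by rewrite {1}/x zS mxE/= -/(x k) -/(y k) -/(th k) -/(w k); ring.
have yS k : y k.+1 = y k + T * (- w k * x k +
    (- a1 * th k * x k + sample vr T (k0 + k) * sin (th k))).
  by rewrite {1}/y zS mxE/= -/(x k) -/(y k) -/(th k) -/(w k); ring.
have thS k : th k.+1 = (1 - a1 * T) * th k.
  by rewrite {1}/th zS mxE/= -/(x k) -/(y k) -/(th k) -/(w k); ring.
have q0 : 0 <= 1 - a1 * T by rewrite subr_ge0.
have q1 : 1 - a1 * T <= 1 by rewrite gerBl mulr_ge0 ?ltW.
have thE k : `|th k| = (1 - a1 * T) ^+ k * `|th 0%N|.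
  elim: k => [|k IH]; first by rewrite mul1r.
  by rewrite thS normrM IH exprS mulrA ger0_norm.
(* Thus [th k ^+ 2] decays at least as fast as the bound on [|th k|], and a single factor [G] serves
   both. *)
have qsq k : ((1 - a1 * T) ^+ k) ^+ 2 <= (1 - a1 * T) ^+ k.
  by rewrite expr2 ler_piMl ?exprn_ge0// exprn_ile1.
have th2E k : th k ^+ 2 = ((1 - a1 * T) ^+ k) ^+ 2 * th 0%N ^+ 2.
  rewrite -real_normK ?num_real// thE exprMn.
  by rewrite [`|th _| ^+ 2]real_normK ?num_real.
pose v k := lyapunov A b (w k) (u k) (x k) (y k).
have vxy k : x k ^+ 2 + y k ^+ 2 <= v k <= D * (x k ^+ 2 + y k ^+ 2).
  by apply: sandwich => //; have [] := uP k.
have v0 k : 0 <= v k.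
  by have /andP[+ _] := vxy k; apply: le_trans; rewrite addr_ge0 ?sqr_ge0.
pose G := C * (`|th 0%N| + th 0%N ^+ 2).
have G0 : 0 <= G by rewrite mulr_ge0// addr_ge0 ?sqr_ge0.
have rE k : enorm (vec2 (x k) (y k)) ^+ 2 = x k ^+ 2 + y k ^+ 2.
  rewrite /enorm sqr_sqrtr; last by rewrite sumr_ge0// => i _; rewrite sqr_ge0.
  by rewrite !big_ord_recl big_ord0 addr0 !mxE.
have step k : v k.+1 <= (1 - g * T) * v k
    + T * G * (1 - a1 * T) ^+ k * (1 + v k).
  pose r : R := enorm (vec2 (x k) (y k)).
  have r0 : 0 <= r by exact: sqrtr_ge0.
  have xr : `|x k| <= r.
    by rewrite -ler_sqr ?nnegrE// real_normK ?num_real// rE lerDl sqr_ge0.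
  have yr : `|y k| <= r.
    by rewrite -ler_sqr ?nnegrE// real_normK ?num_real// rE lerDr sqr_ge0.
  have tr : 0 <= `|th k| * r by rewrite mulr_ge0.
  have Tr : 0 <= T * r by rewrite mulr_ge0// ltW.
  have := normr_ge0 (th k); set h : R := `|th k| => h0.
  have cP : a1 * (h * r) + T * (K * r) + M * h <=
            c * (h * (1 + r) + T * r).
    have := (mulr_ge0 (ltW a10) h0, mulr_ge0 (ltW a10) Tr,
      mulr_ge0 (ltW M0) tr, mulr_ge0 (ltW M0) Tr, mulr_ge0 (ltW K0) h0,
      mulr_ge0 (ltW K0) tr).
    by rewrite -/h => -[[[[[? ?] ?] ?] ?] ?]; rewrite /c; lra.
  apply: (@le_trans _ _ ((1 - g * T) * v k
    + T * (C * (`|th k| + th k ^+ 2)) * (1 + v k))).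
    have [uB du] := uP k; have [u'B _] := uP k.+1.
    apply: (decr T (w k) (w k.+1) (u k) (u k.+1) (x k) (y k) _ _ r (th k)
      _ _ Tgt0 T1 TT0 (wM k) (dwM k) uB u'B du r0 (rE k) _ _ (xS k) (yS k)).
      apply: le_trans cP; apply: (le_trans (ler_normD _ _)).
      apply: lerD; last by rewrite normrM ler_pM// normr_cosB1_le.
      apply: (le_trans (ler_normB _ _)); apply: lerD.
        by rewrite -mulrA !normrM (ger0_norm (ltW a10)) !ler_wpM2l// ltW.
      by rewrite normrM (ger0_norm (ltW Tgt0)) ler_wpM2l ?(ltW Tgt0)// vthK.
    apply: (@le_trans _ _ (a1 * (h * r) + M * h)).
      apply: (le_trans (ler_normD _ _)); apply: lerD.
        rewrite -mulrA !mulNr normrN.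
        by rewrite !normrM (ger0_norm (ltW a10)) !ler_wpM2l// ltW.
      by rewrite normrM ler_pM// normr_sin_le.
    by apply: le_trans cP; rewrite lerD2r lerDl !mulr_ge0// ltW.
  rewrite lerD2l ler_wpM2r ?(addr_ge0 ler01 (v0 k))// -mulrA.
  rewrite ler_wpM2l ?(ltW Tgt0)//.
  rewrite /G -mulrA ler_wpM2l// th2E thE mulrDl [`|_| * _]mulrC.
  by rewrite lerD2l mulrC ler_wpM2l ?sqr_ge0.
have main := perturbed_contraction Tgt0 T1 g0 ga Ta1 G0 v0 step m.
set t := m%:R * T in main *.
have t0 : 0 <= t by rewrite mulr_ge0// ltW.
set h := expR (- (g / 2 * t)) in main *.
pose s := enorm z0.
have s0 : 0 <= s by exact: sqrtr_ge0.
have sE : s ^+ 2 = x 0%N ^+ 2 + y 0%N ^+ 2 + th 0%N ^+ 2 by rewrite -sqnorm.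
have ths : `|th 0%N| <= s.
  rewrite -ler_sqr ?nnegrE// real_normK ?num_real// sE.
  by rewrite lerDr addr_ge0 ?sqr_ge0.
have Gs : G <= C * (s + s ^+ 2).
  by rewrite ler_wpM2l// lerD// sE lerDr addr_ge0 ?sqr_ge0.
have v0s : v 0%N <= D * (s + s ^+ 2).
  have /andP[_ /le_trans] := vxy 0%N; apply; rewrite ler_wpM2l// sE.
  by have := sqr_ge0 (th 0%N); lra.
have ss0 : 0 <= s + s ^+ 2 by rewrite addr_ge0 ?sqr_ge0.
(* The heading error decays at rate [a1], and [g / 2 <= a1]. *)
have th_h : th m ^+ 2 <= s ^+ 2 * h.
  have qh : (1 - a1 * T) ^+ m <= h.
    apply: (le_trans (exprn_1B_le_expR m Ta1)); rewrite ler_expR lerN2 /t.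
    by rewrite [X in _ <= X]mulrCA ler_wpM2r//; lra.
  rewrite th2E mulrC; apply: ler_pM; rewrite ?sqr_ge0//.
    by rewrite sE lerDr addr_ge0 ?sqr_ge0.
  exact: le_trans qh.
(* By monotonicity of the root it is enough to bound the squared norm, which is at most
   [v m + th m ^+ 2]. *)
rewrite -[X in X <= _](ger0_norm (sqrtr_ge0 _)) -sqrtr_sqr ler_wsqrtr//.
rewrite -/z -/s sqnorm.
have /andP[xym _] := vxy m.
apply: (@le_trans _ _ (v m + s ^+ 2 * h)); first exact: lerD.
have h0 : 0 <= h by exact: expR_ge0.
apply: (@le_trans _ _ (((D + 2 / g * expR g * C) * (s + s ^+ 2) *
   expR (C / a1 * (s + s ^+ 2)) + s ^+ 2) * h)).
  rewrite mulrDl lerD2r; apply: (le_trans main); rewrite ler_wpM2r//.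
  apply: ler_pM; rewrite ?expR_ge0//.
  - by rewrite addr_ge0// mulr_ge0// mulr_ge0 ?expR_ge0// divr_ge0// ltW.
  - have : 0 <= 2 / g * expR g by rewrite !mulr_ge0 ?expR_ge0// invr_ge0 ltW.
    by move=> /ler_wpM2l /(_ _ _ Gs); lra.
  - by rewrite ler_expR [X in _ <= X]mulrAC ler_wpM2r// invr_ge0 ltW.
rewrite ler_wpM2r//.
(* Both exponentials are compared with the one in [E]; [n2] bounds [s ^+ 2] through the summand [1]
   of [E]. *)
have e1 : expR (C / a1 * (s + s ^+ 2)) <= expR (E * (s + s ^+ 2)).
  by rewrite ler_expR ler_wpM2r// /E; lra.
have e2 : 1 <= expR (E * (s + s ^+ 2)).
  by rewrite -[X in X <= _]expR0 ler_expR mulr_ge0// ltW.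
have DC0 : 0 <= (D + 2 / g * expR g * C) * (s + s ^+ 2).
  by rewrite mulr_ge0// addr_ge0.
have n1 := ler_wpM2l DC0 e1.
have n2 := ler_wpM2l ss0 e2.
have n3 : 0 <= C / a1 * ((s + s ^+ 2) * expR (E * (s + s ^+ 2))).
  by rewrite mulr_ge0// mulr_ge0 ?expR_ge0.
rewrite {1}/E; lra.
Qed.
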